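(* However the random integers $X$ and $Y$ are jointly distributed on $\{1,\ldots,N\}\times\{1,\ldots,N\}$ (not necessarily independent or uniform), one has $$H(X,Y\mid X\cdot Y) = O\left(\frac{\log N}{\log\log N}\right).$$ That is, there exist constants $C > 0$ and $N_0$ such that for every $N \ge N_0$ and every pair $(X,Y)$ of random variables taking values in $\{1,\ldots,N\}\times\{1,\ldots,N\}$, one has $H(X,Y\mid X\cdot Y) \le C\,\log N/\log\log N$.
   Context: $X \cdot Y$ denotes the ordinary integer product. $H$ denotes Shannon entropy with logarithms to base 2. $H(X,Y\mid X\cdot Y)$ is the conditional entropy (equivocation) of the ordered pair $(X,Y)$ given the product $X\cdot Y$; since $X \cdot Y$ is determined by $(X,Y)$, it equals $H(X,Y) - H(X\cdot Y)$. *)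

(* Defs.v *)
From HB Require Import structures.
From mathcomp Require Import all_boot all_order all_algebra.
From mathcomp Require Import all_classical all_reals all_analysis.

Set Implicit Arguments.
Unset Strict Implicit.
Unset Printing Implicit Defensive.

Import Order.TTheory GRing.Theory Num.Theory.

Local Open Scope classical_set_scope.
Local Open Scope ring_scope.

Definition log2 (R : realType) (x : R) : R := ln x / ln 2.

(* Shannon entropy, in bits, of a probability mass function [p].
   The convention 0 log 0 = 0 holds because of the factor [p u]. The terms are
   nonnegative when [p] takes values in [0, 1], as [\esum] requires. *)
Definition pmf_entropy (R : realType) (U : choiceType) (p : U -> R) : \bar R :=
  \esum_(u in [set: U]) (- (p u * log2 (p u)))%:E.

(* P(A | B); it is 0 when P(B) = 0, because 0^-1 = 0. *)
Definition cond_prob d (T : measurableType d) (R : realType)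
    (P : probability T R) (A B : set T) : R :=
  fine (P (A `&` B)) / fine (P B).

(* H(Z | W) = \sum_w P(W = w) H(Z | W = w), for discrete [Z] and [W]: the events
   [Z = z] and [W = w] are meant to be measurable and the laws of [Z] and [W]
   to be concentrated on countable sets. *)
Definition cond_entropy d (T : measurableType d) (R : realType)
    (P : probability T R) (U V : choiceType) (Z : T -> U) (W : T -> V) :
    \bar R :=
  (\esum_(w in [set: V])
    (P (W @^-1` [set w]) *
     pmf_entropy (fun z => cond_prob P (Z @^-1` [set z]) (W @^-1` [set w]))))%E.

(* Main.v *)
Require Import Defs.
From HB Require Import structures.
From mathcomp Require Import all_boot all_order all_algebra.
From mathcomp Require Import all_classical all_reals all_analysis.
From mathcomp Require Import zify ring lra.

Set Implicit Arguments.
Unset Strict Implicit.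
Unset Printing Implicit Defensive.

Import Order.TTheory GRing.Theory Num.Theory.

Local Open Scope classical_set_scope.
Local Open Scope ring_scope.


(** Given the product w, the pair (X, Y) is determined by X, which divides w;
    so it takes at most d(w) values, where d is the number-of-divisors function.
    An entropy is at most the logarithm of the number of possible values, and
    averaging over w keeps this bound ([cond_entropy_le]). Since w <= N ^ 2,
    everything reduces to the classical estimate
    log d(w) = O(log N / log log N) ([log2_size_divisors_le]).

    For the divisor bound, the prime factors of m are cut at a threshold 2 ^ k.
    The part of a divisor of m made of primes below 2 ^ k is given by 2 ^ k
    exponents, each smaller than L when m < 2 ^ L, so there are at most
    L ^ (2 ^ k) such parts ([size_divisors_smooth]). The cofactor b of m made of
    primes at least 2 ^ k satisfies d(b) ^ k <= b, as each prime factor at most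
    doubles d while multiplying b by at least 2 ^ k ([size_divisors_rough]).
    With 4 ^ k about log N, the first factor contributes about
    sqrt (log N) * log log N to log d(m), which is negligible, and the second
    one at most 2 log N / k, which has the required order. *)

(** * The number of divisors *)

Lemma leq_expn m n k : (m <= n -> m ^ k <= n ^ k)%N.
Proof. by case: k => // k; rewrite leq_exp2r. Qed.

(** A divisor of [p * b] is a divisor of [b] if [p] does not divide it, and [p]
    times a divisor of [b] otherwise. *)
Lemma size_divisors_mulp p b : prime p -> (0 < b)%N ->
  (size (divisors (p * b)) <= 2 * size (divisors b))%N.
Proof.
move=> p_pr b0; have p0 := prime_gt0 p_pr.
have pb0 : (0 < p * b)%N by rewrite muln_gt0 p0.
have -> : (2 * size (divisors b)
    = size (divisors b ++ map (muln p) (divisors b)))%N.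
  by rewrite size_cat size_map mul2n addnn.
apply: uniq_leq_size (divisors_uniq _) _ => d.
rewrite -dvdn_divisors// mem_cat -dvdn_divisors// => dpb.
have [/dvdnP[e de]|pNd] := boolP (p %| d)%N.
  apply/orP; right; apply/mapP; exists e; last by rewrite de mulnC.
  by rewrite -dvdn_divisors// -(dvdn_pmul2l p0) mulnC -de.
by rewrite -(@Gauss_dvdr d p) ?dpb// coprime_sym prime_coprime.
Qed.

(** By induction on [b]: removing a prime factor [p], here the least one, from [b]
    divides the left-hand side by at most [2 ^ k], and the right-hand side by
    [p >= 2 ^ k]. *)
Lemma size_divisors_rough k b : (0 < b)%N ->
    (forall p, prime p -> p %| b -> 2 ^ k <= p)%N ->
  (size (divisors b) ^ k <= b)%N.
Proof.
elim/ltn_ind: b => b IH b0 rough.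
have [->|b1] := eqVneq b 1%N; first by rewrite exp1n.
have p_pr : prime (pdiv b) by apply: pdiv_prime; rewrite ltn_neqAle eq_sym b1.
have [c bc] := dvdnP (pdiv_dvd b).
have c0 : (0 < c)%N by move: b0; rewrite bc muln_gt0 => /andP[].
have cb : (c < b)%N by rewrite bc -[X in (X < _)%N]muln1 ltn_pmul2l// prime_gt1.
have {}IH : (size (divisors c) ^ k <= c)%N.
  apply: IH => // q q_pr qc; apply: rough => //.
  by rewrite bc dvdn_mulr.
apply: (@leq_trans ((2 * size (divisors c)) ^ k)%N).
  by apply: leq_expn; rewrite [in X in (X <= _)%N]bc mulnC size_divisors_mulp.
by rewrite expnMn [leqRHS]bc mulnC leq_mul// rough// pdiv_dvd.
Qed.

(** A divisor of [m] is determined by its exponents at the [t] integers below [t],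
    each smaller than [L], and by its part prime to them, which divides that
    of [m]. *)
Lemma size_divisors_smooth t L m : (0 < m < 2 ^ L)%N ->
  (size (divisors m) <= L ^ t * size (divisors m`_[pred p | t <= p]))%N.
Proof.
case: L => [|L] /andP[m0 mL]; first by move: m0 mL; rewrite expn0; case: m.
set pi := [pred p | _].
pose low d := [ffun i : 'I_t => inord (logn i d) : 'I_L.+1].
rewrite -[X in (X ^ t)%N]card_ord -[X in (_ ^ X)%N]card_ord -card_ffun cardE.
rewrite -(size_allpairs pair) -(size_map (fun d => (low d, d`_pi)%N)).
have logL p d : (d %| m)%N -> (logn p d < L.+1)%N.
  move=> dm; have [p_pr|pN] := boolP (prime p); last by rewrite lognE (negPf pN).
  rewrite -(@ltn_exp2l 2)// (leq_ltn_trans _ mL)//.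
  rewrite (leq_trans _ (dvdn_leq m0 dm))//.
  apply: leq_trans (dvdn_leq (dvdn_gt0 m0 dm) (pfactor_dvdnn p d)).
  by apply: leq_expn; exact: prime_gt1.
apply: uniq_leq_size => [|_ /mapP[d dm ->]]; last first.
  apply/allpairsP; exists (low d, d`_pi)%N; rewrite mem_enum; split => //=.
  by rewrite -dvdn_divisors ?part_gt0// partn_dvd// dvdn_divisors.
rewrite map_inj_in_uniq ?divisors_uniq// => d e.
rewrite -!dvdn_divisors// => dm em [lo hi].
apply: eqn_from_log; [exact: dvdn_gt0 dm|exact: dvdn_gt0 em|] => p /=.
have [pt|tp] := ltnP p t.
  have /(congr1 (@nat_of_ord _)) := congr1 (fun f : {ffun _} => f (Ordinal pt)) lo.
  by rewrite !ffunE !inordK ?logL.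
have ppi : {subset (p : nat_pred) <= pi} by move=> q; rewrite !inE => /eqP ->.
by rewrite -logn_part -(partn_part d ppi) hi (partn_part e ppi) logn_part.
Qed.

(** Here [4 ^ k <= log2 N < 4 ^ k.+1] up to rounding, so that [L = 2 * n.+1],
    which satisfies [N ^ 2 < 2 ^ L], is itself at most [2 ^ (2 * k + 3)]. Raising
    to the power [k] keeps the bound on the rough part free of [k]-th roots. *)
Lemma size_divisors_exp N m (n := trunc_log 2 N) (k := trunc_log 4 n) :
    (1 < N)%N -> (0 < m <= N ^ 2)%N ->
  (size (divisors m) ^ k <= 2 ^ ((2 * k + 3) * 2 ^ k * k) * N ^ 2)%N.
Proof.
move=> N1 /andP[m0 mN].
have Nn : (N < 2 ^ n.+1)%N by exact: trunc_log_ltn.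
have n4 : (n < 4 ^ k.+1)%N by exact: trunc_log_ltn.
have mL : (m < 2 ^ (2 * n.+1))%N.
  by rewrite (leq_ltn_trans mN)// mulnC expnM ltn_exp2r.
have Lk : (2 * n.+1 <= 2 ^ (2 * k + 3))%N.
  rewrite (leq_trans (_ : _ <= 2 * 4 ^ k.+1)%N) ?leq_mul2l//.
  by rewrite -(expnM 2 2) -expnS leq_exp2l//; lia.
set b := (m`_[pred p | 2 ^ k <= p])%N.
have b0 : (0 < b)%N by exact: part_gt0.
have rough : (size (divisors b) ^ k <= N ^ 2)%N.
  apply: leq_trans (leq_trans (dvdn_leq m0 (dvdn_part _ _)) mN).
  apply: size_divisors_rough => // p p_pr pb.
  have : p \in \pi(b) by rewrite mem_primes p_pr b0.
  by rewrite /b pi_of_part// !inE => /andP[].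
have := @size_divisors_smooth (2 ^ k) (2 * n.+1) m; rewrite m0 mL => /(_ isT).
move=> /(@leq_expn _ _ k) /leq_trans; apply.
rewrite expnMn leq_mul// [in leqRHS]expnM leq_expn// expnM.
by rewrite leq_expn.
Qed.

(** * The divisor bound in logarithmic form *)

Section Log2.
Variable R : realType.
Implicit Types x y : R.

Lemma ln2_gt0 : 0 < ln 2 :> R.
Proof. by rewrite ln_gt0// ltr1n. Qed.

Lemma log2M x y : 0 < x -> 0 < y -> log2 (x * y) = log2 x + log2 y.
Proof. by move=> x0 y0; rewrite /log2 lnM ?posrE// mulrDl. Qed.

Lemma log2X x n : 0 < x -> log2 (x ^+ n) = n%:R * log2 x.
Proof. by move=> x0; rewrite /log2 lnXn// mulr_natl mulrnAl. Qed.

Lemma log2_exp2 n : log2 (2 ^+ n) = n%:R :> R.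
Proof. by rewrite log2X// /log2 divff ?mulr1// gt_eqF// ln2_gt0. Qed.

Lemma le_log2 x y : 0 < x -> x <= y -> log2 x <= log2 y.
Proof.
move=> x0 xy; rewrite /log2 ler_pM2r ?invr_gt0 ?ln2_gt0//.
by rewrite ler_ln// posrE// (lt_le_trans x0).
Qed.

Lemma log2_ge0 x : 1 <= x -> 0 <= log2 x.
Proof. by move=> x1; rewrite /log2 divr_ge0 ?ln_ge0 ?ler1n. Qed.

End Log2.

(** With [x = log2 N], [y = log2 x] and [l] the left-hand side, the previous bound
    reads [k * l <= (2 * k + 3) * 2 ^ k * k + 2 * x]. The first term is at most
    [4 * 4 ^ k <= 4 * x], hence [k * l <= 6 * x], and [y <= 2 * k.+1 <= 4 * k]
    gives [l * y <= 24 * x]. *)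
Lemma log2_size_divisors_le (R : realType) N m :
    (16 <= N)%N -> (0 < m <= N ^ 2)%N ->
  log2 (size (divisors m))%:R <= 24 * (log2 N%:R / log2 (log2 N%:R)) :> R.
Proof.
move=> N16 mN; have m0 : (0 < m)%N by case/andP: mN.
have N1 : (1 < N)%N by exact: leq_trans N16.
have := size_divisors_exp N1 mN.
set n := trunc_log 2 N; set k := trunc_log 4 n; set D := size _ => Dk.
have N0 : 0 < N%:R :> R by rewrite ltr0n; apply: ltn_trans N1.
set x := log2 N%:R; set l := log2 D%:R.
have D0 : (0 < D)%N by rewrite /D; case: divisors (divisor1 m).
have l0 : 0 <= l by rewrite log2_ge0// ler1n.
have nx : n%:R <= x.
  by rewrite -(@log2_exp2 R) le_log2// -natrX ler_nat trunc_logP// ltnW.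
have xn : x <= n.+1%:R.
  by rewrite -(@log2_exp2 R) le_log2// -natrX ler_nat ltnW// trunc_log_ltn.
have n4 : (4 <= n)%N by apply: trunc_log_max.
have k1 : (1 <= k)%N by apply: trunc_log_max.
have kn : (4 ^ k <= n)%N by apply: trunc_logP => //; apply: leq_trans n4.
have nk : (n.+1 <= 4 ^ k.+1)%N by apply: trunc_log_ltn.
have x4 : 4 <= x by apply: le_trans nx; rewrite ler_nat.
have x0 : 0 < x by apply: lt_le_trans x4.
have kx : 4 ^+ k <= x by apply: le_trans nx; rewrite -natrX ler_nat.
set y := log2 x.
have y2 : 2 <= y.
  have -> : 2 = log2 (2 ^+ 2) :> R by rewrite log2_exp2.
  by rewrite le_log2//; apply: le_trans x4; rewrite -natrX ler_nat.
have yk : y <= 2 * k.+1%:R.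
  rewrite -natrM -(@log2_exp2 R) le_log2// (le_trans xn)//.
  by rewrite -natrX ler_nat expnM.
have kl : k%:R * l <= ((2 * k + 3) * 2 ^ k * k)%:R + 2 * x.
  have := @le_log2 R (D%:R ^+ k) (2 ^+ ((2 * k + 3) * 2 ^ k * k) * N%:R ^+ 2).
  rewrite exprn_gt0 ?ltr0n// -!natrX -natrM ler_nat => /(_ isT Dk).
  by rewrite natrM !natrX log2M ?exprn_gt0// log2_exp2 !log2X ?ltr0n// ltnW.
(* The inductive step on [k = j.+3] needs [6 < 2 ^ k]. *)
have k2 : ((2 * k + 3) * k <= 4 * 2 ^ k)%N.
  case: (k) => [//|[//|[//|j]]]; elim: j => // j.
  by rewrite expnS; have : (6 < 2 ^ j.+3)%N; rewrite ?expnS; nia.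
have k4 : ((2 * k + 3) * 2 ^ k * k)%:R <= 4 * x.
  have : ((2 * k + 3) * 2 ^ k * k)%:R <= (4 * 4 ^ k)%:R :> R.
    by rewrite ler_nat (expnMn 2 2 k); nia.
  by move=> /le_trans; apply; rewrite natrM natrX; lra.
have k1R : 1 <= k%:R :> R by rewrite ler1n.
rewrite mulrA ler_pdivlMr; last lra.
have yk4 : y <= 4 * k%:R by move: yk; rewrite -natr1; lra.
have := ler_wpM2l l0 yk4; lra.
Qed.

(** * Entropy and the number of values *)

(** Gibbs' inequality against the uniform law on [s]: with [n] the size of [s],
    [ln z <= z - 1] at [z = (n * p u)^-1], multiplied by [p u], bounds
    [- p u * ln (p u)] by [p u * ln n + (n^-1 - p u)], and the parenthesis sums
    to 0 over [s]. *)
Lemma pmf_entropy_le_log2_size (R : realType) (U : choiceType) (p : U -> R)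
    (s : seq U) :
    uniq s -> (forall u, 0 <= p u) -> (forall u, u \notin s -> p u = 0) ->
    \sum_(u <- s) p u = 1 ->
  (pmf_entropy p <= (log2 (size s)%:R)%:E)%E.
Proof.
move=> s_uniq p0 p_out p_sum.
have p1 u : p u <= 1.
  have [us|/p_out->//] := boolP (u \in s).
  by rewrite -p_sum (bigD1_seq u)//= lerDl sumr_ge0.
have n0 : 0 < (size s)%:R :> R.
  by rewrite ltr0n; case: (s) p_sum => // /esym/eqP; rewrite big_nil oner_eq0.
set n := (size s)%:R in n0 *.
have term u : - (p u * log2 (p u)) <= (p u * ln n + (n^-1 - p u)) / ln 2.
  rewrite /log2 mulrA -mulNr ler_pM2r ?invr_gt0 ?ln2_gt0//.
  have [->|pu] := eqVneq (p u) 0.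
    by rewrite !mul0r oppr0 add0r addr0 ltW// invr_gt0.
  have {}pu : 0 < p u by rewrite lt_neqAle eq_sym pu p0.
  have np0 : 0 < n * p u by rewrite mulr_gt0.
  have := @le_ln1Dx R ((n * p u)^-1 - 1).
  rewrite ltrBDr addNr invr_gt0 => /(_ np0).
  rewrite addrCA subrr addr0 lnV ?posrE// lnM ?posrE//.
  move=> /(ler_wpM2l (ltW pu)).
  have -> : p u * ((n * p u)^-1 - 1) = n^-1 - p u.
    by field; rewrite !gt_eqF.
  lra.
rewrite /pmf_entropy.
rewrite (_ : (\esum_(u in [set: U]) _)%E =
    (\esum_(u in [set` s]) (- (p u * log2 (p u)))%:E)%E); last first.
  rewrite [RHS]esum_mkcond; apply: eq_esum => u _; case: ifPn => // us.
  by rewrite p_out ?mul0r ?oppr0//; apply: contraNN us => us; rewrite mem_setE.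
rewrite esum_fset//; last first.
  move=> u _; rewrite lee_fin oppr_ge0 mulr_ge0_le0//.
  by rewrite /log2 mulr_le0_ge0 ?ln_le0// invr_ge0 ltW// ln2_gt0.
rewrite -fsbig_seq// sumEFin lee_fin (le_trans (ler_sum _ (fun u _ => term u)))//.
rewrite -mulr_suml !big_split/= -mulr_suml p_sum sumrN p_sum mul1r.
by rewrite big_const_seq count_predT iter_addr_0 -[_ *+ _]mulr_natl divff
  ?gt_eqF// subrr addr0.
Qed.

(** Only the [w] with [P (W = w) > 0] contribute to the sum, and such a [w] is a
    value of [W], so that [Z] given [W = w] is a genuine law carried by [s w]. *)
Lemma cond_entropy_le (R : realType) d (T : measurableType d)
    (P : probability T R) (U V : choiceType) (Z : T -> U) (W : T -> V)
    (s : V -> seq U) (c : R) :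
    (forall z, measurable (Z @^-1` [set z])) ->
    (forall w, measurable (W @^-1` [set w])) ->
    (forall w, uniq (s w)) -> (forall t, Z t \in s (W t)) ->
    0 <= c -> (forall t, log2 (size (s (W t)))%:R <= c) ->
  (cond_entropy P Z W <= c%:E)%E.
Proof.
move=> mZ mW s_uniq sP c0 sc; apply: ge_ereal_sup => _ [F [finF _] <-].
have trivW : trivIset F (fun w => W @^-1` [set w]).
  by move=> w w' _ _ [t [/= <- <-]].
apply: (@le_trans _ _ (\sum_(w \in F) (P (W @^-1` [set w]) * c%:E))%E); last first.
  rewrite -ge0_mule_fsuml// -measure_fin_bigcup// -[leRHS]mul1e.
  rewrite lee_wpmul2r ?lee_fin// probability_le1//.
  exact: fin_bigcup_measurable.
apply: lee_fsum => // w _.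
have [->|Pw] := eqVneq (P (W @^-1` [set w])) 0%E; first by rewrite !mul0e.
have [t Wt] : W @^-1` [set w] !=set0.
  by apply/set0P; apply: contraNneq Pw => ->; rewrite measure0.
rewrite lee_wpmul2l//.
apply: (le_trans (@pmf_entropy_le_log2_size _ _ _ (s w) _ _ _ _)) => //.
- by move=> z; rewrite /cond_prob divr_ge0// fine_ge0.
- move=> z zs; rewrite /cond_prob (_ : _ `&` _ = set0) ?measure0 ?mul0r//.
  apply/seteqP; split => // t' [/= Zt' Wt'].
  by move: zs; rewrite -Zt' -Wt' sP.
- rewrite /cond_prob -mulr_suml sum_fine/=; last first.
    by move=> z _; rewrite fin_num_measure//; apply: measurableI.
  have -> : (\sum_(z <- s w) P (Z @^-1` [set z] `&` W @^-1` [set w]) =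
      P (W @^-1` [set w]))%E.
    rewrite fsbig_seq// -measure_fin_bigcup//.
    - congr (P _); apply/seteqP; split => [t' [z _ []]//|t' /= Wt'].
      by exists (Z t') => //=; rewrite -Wt'.
    - by move=> z z' _ _ [t' [[/= <- _] [<- _]]].
    - by move=> z _; apply: measurableI.
  by rewrite divff// fine_eq0// fin_num_measure.
- by rewrite lee_fin -Wt.
Qed.

(** * Equivocation of the factors of a product *)

Theorem mainTheorem4 (R : realType) :
  exists (C : R) (N0 : nat), 0 < C /\
    forall (N : nat), (N0 <= N)%N ->
    forall (d : measure_display) (T : measurableType d) (P : probability T R)
      (X Y : {RV P >-> nat}),
      (forall t : T, (1 <= X t <= N)%N) ->
      (forall t : T, (1 <= Y t <= N)%N) ->
      (cond_entropy P (fun t => (X t, Y t)) (fun t => (X t * Y t)%N)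
        <= (C * (log2 N%:R / log2 (log2 N%:R)))%:E)%E.
Proof.
exists 24, 16%N; split=> [|N N16 d T P X Y XN YN]; first by rewrite ltr0n.
have mX a : measurable (X @^-1` [set a]).
  by rewrite -[X in measurable X]setTI; apply: measurable_funP.
have mY b : measurable (Y @^-1` [set b]).
  by rewrite -[X in measurable X]setTI; apply: measurable_funP.
have mXY (z : nat * nat) : measurable ((fun t => (X t, Y t)) @^-1` [set z]).
  rewrite (_ : _ @^-1` _ = X @^-1` [set z.1] `&` Y @^-1` [set z.2]).
    exact: measurableI.
  by case: z => a b; apply/seteqP; split => t /= [-> ->].
(* The product is a function of the pair, which has countably many values. *)
have mW w : measurable ((fun t => X t * Y t)%N @^-1` [set w]).
  rewrite (_ : _ @^-1` _ = \bigcup_(z : nat * nat) if z.1 * z.2 == w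
      then (fun t => (X t, Y t)) @^-1` [set z] else set0)%N.
    by apply: countable_bigcupT_measurable => // z; case: ifP.
  apply/seteqP; split => [t /= <-|t /= [[a b] _]/=]; last first.
    by case: ifP => [/eqP <- [-> ->]|].
  by exists (X t, Y t) => //=; rewrite eqxx.
have XY t : (0 < X t * Y t <= N ^ 2)%N.
  have /andP[X1 XN'] := XN t; have /andP[Y1 YN'] := YN t.
  by rewrite muln_gt0 X1 Y1 -mulnn leq_mul.
pose s w := [seq (a, w %/ a)%N | a <- divisors w].
apply: (@cond_entropy_le _ _ _ _ _ _ _ _ s) => //.
- by move=> w; rewrite map_inj_uniq ?divisors_uniq// => a b [].
- move=> t; have /andP[X1 _] := XN t; apply/mapP; exists (X t).
    by rewrite -dvdn_divisors ?dvdn_mulr//; case/andP: (XY t).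
  by rewrite mulKn.
(* The bound is nonnegative, being at least [log2 (d 1) = 0]. *)
- have : (0 < 1 <= N ^ 2)%N by rewrite expn_gt0 (leq_trans _ N16).
  move=> /(log2_size_divisors_le R N16).
  by rewrite (_ : divisors 1 = [:: 1%N])// /log2 ln1 mul0r.
- by move=> t; rewrite size_map log2_size_divisors_le.
Qed.
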